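(* Let $P=\{x\in\mathbb{R}^n : H^Tx\le \mathbb{1}\}$ be a full-dimensional polytope with the origin in its interior, with $f$ facets, $v$ vertices and slack matrix $S\in\mathbb{R}^{f\times v}$, and let $K\subset\mathbb{R}^m$ be a closed convex cone. Let $A$ be a nonnegative $K^*$-map from $\mathbb{R}^f$ to $\mathbb{R}^m$ such that $A^*(K)$ is closed, and let $B$ be a nonnegative $K$-map from $\mathbb{R}^v$ to $\mathbb{R}^m$. Let $\Delta:=S-A^*\circ B$ be the factorization error. Then: 1. $\frac{1}{1+\varepsilon}P\subseteq \mathrm{Inn}_P(A)$ for $\varepsilon=\|\Delta\|_{1,2}$; 2. $\mathrm{Out}_P(B)\subseteq(1+\varepsilon)P$ for $\varepsilon=\|\Delta\|_{2,\infty}$, where $\|\Delta\|_{1,2}=\max_{j}\|\Delta e_j\|$ is the maximum Euclidean norm of a column of $\Delta$ and $\|\Delta\|_{2,\infty}=\max_i\|\Delta^*e_i\|$ is the maximum Euclidean norm of a row of $\Delta$.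
   Context: Dual spaces are identified with the spaces themselves via the standard inner product; $\|\cdot\|$ is the Euclidean norm and $\mathbb{1}$ is the all-ones vector. $H=[h_1\ \cdots\ h_f]$ is an $n\times f$ matrix such that each inequality $\langle h_i,x\rangle\le 1$ defines a facet of $P$ (one for each facet); $p_1,\dots,p_v$ are the vertices of $P$ and $V=[p_1\ \cdots\ p_v]$ is $n\times v$. The slack matrix $S$ has entries $S_{ij}=1-\langle h_i,p_j\rangle$. $K^*=\{y : \langle y,x\rangle\ge 0\ \forall x\in K\}$ is the dual cone. A nonnegative $K$-map $B:\mathbb{R}^v\to\mathbb{R}^m$ is a linear map with $B(\mathbb{R}^v_+)\subseteq K$; a nonnegative $K^*$-map $A:\mathbb{R}^f\to\mathbb{R}^m$ satisfies $A(\mathbb{R}^f_+)\subseteq K^*$. $A^*$ is the adjoint (transpose) of $A$, and $H^*(x)=H^Tx$. Cones: $\mathcal{O}_{in}^k=\{x\in\mathbb{R}^k : \sqrt{k-1}\,\|x\|\le \mathbb{1}^Tx\}$ and $\mathcal{O}_{out}^k=\{x\in\mathbb{R}^k : \|x\|\le \mathbb{1}^Tx\}$. Definitions: $\mathrm{Inn}_P(A)=\{x\in\mathbb{R}^n : \exists y\in K,\ \mathbb{1}-H^*(x)-A^*(y)\in\mathcal{O}_{in}^f\}$, $\mathrm{Out}_P(B)=\{V(z) : z\in\mathcal{O}_{out}^v,\ \mathbb{1}^Tz\le 1,\ B(z)\in K\}$. *)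

(* Defs.v *)
From HB Require Import structures.
From mathcomp Require Import all_boot all_order all_algebra.
From mathcomp Require Import all_classical all_reals all_analysis.
Import Order.TTheory GRing.Theory Num.Theory.
Import numFieldNormedType.Exports.

Set Implicit Arguments.
Unset Strict Implicit.
Unset Printing Implicit Defensive.

Local Open Scope classical_set_scope.
Local Open Scope ring_scope.

(* Vectors are columns 'cV[R]_k; linear maps between them are matrices acting
   by left multiplication, and the adjoint of A is A^T. *)

Definition dotv (R : realType) (k : nat) (x y : 'cV[R]_k) : R :=
  \sum_(i < k) x i 0 * y i 0.

(* The library norm `|x| on 'cV[R]_k is the sup norm, hence this one. *)
Definition enorm (R : realType) (k : nat) (x : 'cV[R]_k) : R :=
  Num.sqrt (dotv x x).

Definition ones (R : realType) (k : nat) : 'cV[R]_k := const_mx 1.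
Arguments ones {R k}.

Definition nonneg_orthant (R : realType) (k : nat) : set 'cV[R]_k :=
  [set x | forall i, 0 <= x i 0].

Definition convex_hull (R : realType) (n : nat) (X : set 'cV[R]_n) :
    set 'cV[R]_n :=
  smallest (fun C : set 'cV[R]_n => @convex_set R 'cV[R]_n C) X.

Definition affine_hull (R : realType) (n : nat) (X : set 'cV[R]_n) :
    set 'cV[R]_n :=
  [set x | exists (k : nat) (a : 'I_k -> R) (p : 'I_k -> 'cV[R]_n),
    [/\ forall i, X (p i), \sum_i a i = 1 & x = \sum_i a i *: p i]].

(* No d satisfies this for X = set0. *)
Definition has_dim (R : realType) (n : nat) (X : set 'cV[R]_n) (d : nat) :
    Prop :=
  exists (x0 : 'cV[R]_n) (U : {vspace 'cV[R]_n}),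
    \dim U = d /\ affine_hull X = [set x0 + u | u in [set u | u \in U]].

Definition polytope (R : realType) (n : nat) (P : set 'cV[R]_n) : Prop :=
  exists X : set 'cV[R]_n, finite_set X /\ P = convex_hull X.

Definition face (R : realType) (n : nat) (P F : set 'cV[R]_n) : Prop :=
  exists (c : 'cV[R]_n) (d : R),
    (forall x, P x -> dotv c x <= d) /\ F = P `&` [set x | dotv c x = d].

(* For a full-dimensional P in R^n: a face of dimension n - 1. *)
Definition facet (R : realType) (n : nat) (P F : set 'cV[R]_n) : Prop :=
  face P F /\ exists d : nat, has_dim F d /\ d.+1 = n.

Definition vertex (R : realType) (n : nat) (P : set 'cV[R]_n)
    (p : 'cV[R]_n) : Prop :=
  face P [set p].

Definition polyhedron (R : realType) (n f : nat) (H : 'M[R]_(n, f)) :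
    set 'cV[R]_n :=
  [set x | forall i : 'I_f, (H^T *m x) i 0 <= 1].

(* i |-> {x in P | <h_i, x> = 1} is a bijection from the columns of H onto the
   facets of P. *)
Definition facet_matrix (R : realType) (n f : nat) (P : set 'cV[R]_n)
    (H : 'M[R]_(n, f)) : Prop :=
  let F (i : 'I_f) := P `&` [set x | dotv (col i H) x = 1] in
  [/\ forall i, facet P (F i),
      injective F &
      forall G, facet P G -> exists i, G = F i].

Definition vertex_matrix (R : realType) (n v : nat) (P : set 'cV[R]_n)
    (V : 'M[R]_(n, v)) : Prop :=
  [/\ forall j, vertex P (col j V),
      injective (fun j => col j V) &
      forall p, vertex P p -> exists j, p = col j V].

Definition slack_matrix (R : realType) (n f v : nat) (H : 'M[R]_(n, f))
    (V : 'M[R]_(n, v)) : 'M[R]_(f, v) :=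
  \matrix_(i, j) (1 - dotv (col i H) (col j V)).

Definition convex_cone (R : realType) (m : nat) (K : set 'cV[R]_m) : Prop :=
  [/\ K !=set0,
      @convex_set R 'cV[R]_m K &
      forall (a : R) x, 0 <= a -> K x -> K (a *: x)].

Definition dual_cone (R : realType) (m : nat) (K : set 'cV[R]_m) :
    set 'cV[R]_m :=
  [set y | forall x, K x -> 0 <= dotv y x].

Definition nonneg_map (R : realType) (m k : nat) (K : set 'cV[R]_m)
    (M : 'M[R]_(m, k)) : Prop :=
  (fun x : 'cV[R]_k => M *m x) @` @nonneg_orthant R k `<=` K.

Definition cone_in (R : realType) (k : nat) : set 'cV[R]_k :=
  [set x | Num.sqrt (k%:R - 1) * enorm x <= dotv ones x].

Definition cone_out (R : realType) (k : nat) : set 'cV[R]_k :=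
  [set x | enorm x <= dotv ones x].

Definition Inn (R : realType) (n f m : nat) (H : 'M[R]_(n, f))
    (K : set 'cV[R]_m) (A : 'M[R]_(m, f)) : set 'cV[R]_n :=
  [set x | exists y, K y /\ @cone_in R f (ones - H^T *m x - A^T *m y)].

Definition Out (R : realType) (n v m : nat) (V : 'M[R]_(n, v))
    (K : set 'cV[R]_m) (B : 'M[R]_(m, v)) : set 'cV[R]_n :=
  [set V *m z | z in
    [set z | [/\ @cone_out R v z, dotv ones z <= 1 & K (B *m z)]]].

Definition norm12 (R : realType) (f v : nat) (D : 'M[R]_(f, v)) : R :=
  \big[Num.max/0]_(j < v) enorm (col j D).

Definition norm2oo (R : realType) (f v : nat) (D : 'M[R]_(f, v)) : R :=
  \big[Num.max/0]_(i < f) enorm (col i D^T).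

Definition dilate (R : realType) (n : nat) (a : R) (P : set 'cV[R]_n) :
    set 'cV[R]_n :=
  [set a *: x | x in P].

(* Main.v *)
(* A point of P is V z with z >= 0 and 1^T z = 1, since a polytope is the hull
   of its vertices.  With e = ||Delta||_{1,2} and y = B z / (1 + e),
     1 - H^T (V z) / (1 + e) - A^T y = (e 1 + Delta z) / (1 + e),
   and e 1 + Delta z lies in O_in because the ball of radius e around e 1 does
   and ||Delta z|| <= e.  For the outer inclusion,
     <h_i, V z> = 1^T z - <A e_i, B z> - (Delta z)_i,
   where <A e_i, B z> >= 0 and Cauchy-Schwarz bounds the last term by
   ||Delta||_{2,oo} ||z||, with ||z|| <= 1^T z <= 1.
   That vertices generate the polytope is obtained without compactness:
   separation from a finitely generated hull follows from Gordan's theorem,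
   which is proved by elimination. *)
Require Import Defs.
From HB Require Import structures.
From mathcomp Require Import all_boot all_order all_algebra.
From mathcomp Require Import all_classical all_reals all_analysis.
From mathcomp Require Import ring lra.
Import Order.TTheory GRing.Theory Num.Theory.
Import numFieldNormedType.Exports.

Local Open Scope classical_set_scope.
Local Open Scope ring_scope.

(** * Inner product and Euclidean norm *)

Section InnerProduct.
Context {R : realType} {k : nat}.
Implicit Types (x y z : 'cV[R]_k) (a b : R).

Lemma dotvE x y : dotv x y = (x^T *m y) 0 0.
Proof. by rewrite mxE; apply: eq_bigr => i _; rewrite mxE. Qed.

Lemma dotvC x y : dotv x y = dotv y x.
Proof. by apply: eq_bigr => i _; rewrite mulrC. Qed.

Lemma dotvDr x y z : dotv x (y + z) = dotv x y + dotv x z.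
Proof. by rewrite !dotvE mulmxDr mxE. Qed.

Lemma dotvZr a x y : dotv x (a *: y) = a * dotv x y.
Proof. by rewrite !dotvE -scalemxAr mxE. Qed.

Lemma dotvDl x y z : dotv (x + y) z = dotv x z + dotv y z.
Proof. by rewrite !(dotvC _ z) dotvDr. Qed.

Lemma dotvZl a x y : dotv (a *: x) y = a * dotv x y.
Proof. by rewrite !(dotvC _ y) dotvZr. Qed.

Lemma dotvBr x y z : dotv x (y - z) = dotv x y - dotv x z.
Proof. by rewrite -scaleN1r dotvDr dotvZr mulN1r. Qed.

Lemma dotvBl x y z : dotv (x - y) z = dotv x z - dotv y z.
Proof. by rewrite !(dotvC _ z) dotvBr. Qed.

Definition dotv_lin := (dotvBl, dotvBr, dotvDl, dotvDr, dotvZl, dotvZr).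

Lemma dotv_ge0 x : 0 <= dotv x x.
Proof. by apply: sumr_ge0 => i _; rewrite -expr2 sqr_ge0. Qed.

Lemma dotv_eq0 x : (dotv x x == 0) = (x == 0).
Proof.
apply/eqP/eqP => [/eqP|->]; last first.
  by rewrite /dotv big1 // => i _; rewrite mxE mul0r.
rewrite psumr_eq0 => [/allP x0|i _]; last by rewrite -expr2 sqr_ge0.
apply/matrixP => i j; rewrite ord1 mxE.
by have := x0 i (mem_index_enum _); rewrite /= mulf_eq0 orbb => /eqP.
Qed.

Lemma dotv_gt0 x : (0 < dotv x x) = (x != 0).
Proof. by rewrite lt_neqAle dotv_ge0 andbT eq_sym dotv_eq0. Qed.

Lemma dotv_onesE x : dotv ones x = \sum_i x i 0.
Proof. by apply: eq_bigr => i _; rewrite mxE mul1r. Qed.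

Lemma dotv_ones : dotv (@ones R k) ones = k%:R.
Proof.
rewrite dotv_onesE (eq_bigr (fun=> 1)) => [|i _]; last by rewrite mxE.
by rewrite sumr_const card_ord.
Qed.

Lemma enorm_ge0 x : 0 <= enorm x.
Proof. exact: sqrtr_ge0. Qed.

Lemma sqr_enorm x : enorm x ^+ 2 = dotv x x.
Proof. exact/sqr_sqrtr/dotv_ge0. Qed.

Lemma enorm_le x a : 0 <= a -> (enorm x <= a) = (dotv x x <= a ^+ 2).
Proof.
by move=> a0; rewrite -sqr_enorm ler_pXn2r // ?nnegrE ?enorm_ge0.
Qed.

(** The squared norm of [dotv y y *: x - dotv x y *: y] is [dotv y y] times the gap between the
    squared sides. *)
Lemma cauchy_schwarz x y : `|dotv x y| <= enorm x * enorm y.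
Proof.
rewrite -ler_sqr ?nnegrE ?mulr_ge0 ?enorm_ge0 // real_normK ?num_real //.
rewrite exprMn !sqr_enorm; have [->|y0] := eqVneq y 0.
  by rewrite -(scale0r (0 : 'cV[R]_k)) !dotvZr !mul0r expr0n mulr0.
have yy : 0 < dotv y y by rewrite dotv_gt0.
have := dotv_ge0 (dotv y y *: x - dotv x y *: y).
rewrite !dotv_lin (dotvC y x) => h.
rewrite -subr_ge0 -(pmulr_rge0 _ yy); apply: le_trans h _.
by rewrite le_eqVlt; apply/orP; left; apply/eqP; ring.
Qed.

End InnerProduct.

Lemma dotv_adjoint (R : realType) (p q : nat) (M : 'M[R]_(p, q))
    (x : 'cV[R]_q) (y : 'cV[R]_p) : dotv (M *m x) y = dotv x (M^T *m y).
Proof. by rewrite !dotvE trmx_mul mulmxA. Qed.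

(** * Convex hulls: alternatives, separation, generation by vertices *)

Section ConvexHull.
Context {R : realType} {n : nat}.
Implicit Types (C X : set 'cV[R]_n) (x y : 'cV[R]_n) (s : seq 'cV[R]_n).

Lemma convex_setP C :
  @convex_set R 'cV[R]_n C <->
  forall x y (t : R), 0 <= t -> t <= 1 -> C x -> C y ->
    C (t *: x + (1 - t) *: y).
Proof.
split=> [cC x y t t0 t1 Cx Cy|cC x y t].
  have := @cC x y (Itv01 t0 t1).
  by rewrite !inE => /(_ Cx Cy).
by rewrite !inE => Cx Cy; apply: cC.
Qed.

Lemma convex_hull_convex X : @convex_set R 'cV[R]_n (convex_hull X).
Proof.
apply/convex_setP => x y t t0 t1 Hx Hy C [cC XC].
by move/convex_setP: (cC); apply=> //; [apply: Hx|apply: Hy].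
Qed.

Lemma sub_convex_hull X : X `<=` convex_hull X.
Proof. exact: sub_gen_smallest. Qed.

Lemma convex_hull_sub C X :
  @convex_set R 'cV[R]_n C -> X `<=` C -> convex_hull X `<=` C.
Proof. exact: smallest_sub. Qed.

(** Allowing every [e] up to [d] lets the induction shrink [d] at each new element. *)
Lemma positive_perturbation s (f g : 'cV[R]_n -> R) :
  {in s, forall y, 0 < f y} ->
  exists2 d, 0 < d & forall e, 0 < e -> e <= d ->
    {in s, forall y, 0 < f y + e * g y}.
Proof.
elim: s => [|y s IHs] fs; first by exists 1.
have [|d d0 Hd] := IHs; first by move=> z zs; apply: fs; rewrite inE zs orbT.
have fy : 0 < f y by apply: fs; rewrite mem_head.
have q0 : 0 < 1 + `|g y| by rewrite ltr_pwDl.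
(* The summand 1 keeps the denominator positive and the resulting bound on [e * g y] strict. *)
exists (Num.min d (f y / (1 + `|g y|))).
  by rewrite lt_min d0 divr_gt0.
move=> e e0; rewrite le_min => /andP[ed ef] z; rewrite inE => /orP[/eqP->|].
  rewrite ler_pdivlMr // in ef; have := ler_norm (- g y); rewrite normrN.
  nra.
exact: Hd.
Qed.

(* Gordan's alternative, by eliminating one vector [b] at a time: each [y] is
   replaced by the point where the segment [y, b] meets the hyperplane
   orthogonal to [c]. *)
Lemma gordan s :
  (exists c, {in s, forall y, 0 < dotv c y}) \/ convex_hull [set` s] 0.
Proof.
have [l] := ubnP (size s); elim: l s => // l IHl [|b s] /=.
  by move=> _; left; exists 0.
rewrite ltnS => sl.
have hb : convex_hull [set` b :: s] b.
  by apply: sub_convex_hull; rewrite /= mem_head.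
have hs y : y \in s -> convex_hull [set` b :: s] y.
  by move=> ys; apply: sub_convex_hull; rewrite /= inE ys orbT.
have [b0|b0] := eqVneq b 0; first by right; rewrite -b0.
have [[c cs]|h0] := IHl s sl; last first.
  right; move: h0; apply: convex_hull_sub; first exact: convex_hull_convex.
  by move=> y /= /hs.
have [cb|cb] := ltP 0 (dotv c b).
  by left; exists c => y; rewrite inE => /orP[/eqP->//|/cs].
pose q y := dotv c y - dotv c b.
have q0 y : y \in s -> 0 < q y by move=> /cs; rewrite /q; lra.
pose r y := (dotv c y / q y) *: b + (1 - dotv c y / q y) *: y.
have [|[d ds]|h0] := IHl (map r s); first by rewrite size_map.
  (* The value of this functional at [y] is [q y * dotv d (r y)]. *)
  have es : {in s, forall y, 0 < dotv (dotv d b *: c - dotv c b *: d) y}.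
    move=> y ys; have := ds _ (map_f r ys); have qy := q0 _ ys.
    rewrite /r !dotv_lin => /(mulr_gt0 qy); congr (0 < _).
    have : q y != 0 by rewrite gt_eqF.
    by rewrite /q => nz; field.
  (* The functional vanishes at [b]; adding a small multiple of [b], which is nonzero, makes it
     positive there too. *)
  have [t t0 /(_ t t0 (lexx _)) ts] := positive_perturbation _ _ (dotv b) es.
  left; exists (dotv d b *: c - dotv c b *: d + t *: b) => y.
  rewrite inE => /orP[/eqP->|/ts]; last by move=> h; rewrite dotvDl dotvZl.
  have bb : 0 < t * dotv b b by rewrite mulr_gt0 // dotv_gt0.
  by rewrite !dotv_lin (mulrC (dotv d b)) subrr add0r.
right; move: h0; apply: convex_hull_sub; first exact: convex_hull_convex.
move=> _ /= /mapP[y ys ->]; have qy := q0 _ ys; have cy := cs _ ys.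
move/convex_setP: (convex_hull_convex [set` b :: s]); apply => //.
- by rewrite divr_ge0 // ltW.
- by rewrite ler_pdivrMr // mul1r /q; lra.
- exact: hs.
Qed.

(** Gordan's alternative is applied to the differences [x - y]: if 0 lies in their hull, then [x]
    lies in the hull of [s]. *)
Lemma separate_from_hull s x :
  (exists c, {in s, forall y, dotv c y < dotv c x}) \/
  convex_hull [set` s] x.
Proof.
have [[c cs]|h0] := gordan [seq x - y | y <- s].
  left; exists c => y ys; have := cs _ (map_f _ ys).
  by rewrite dotvBr subr_gt0.
right; pose D := [set z | convex_hull [set` s] (x - z)].
suff : D 0 by rewrite /D /= subr0.
move: h0; apply: convex_hull_sub.
  apply/convex_setP => y z t t0 t1; rewrite /D /= => Dy Dz.
  have -> : x - (t *: y + (1 - t) *: z) = t *: (x - y) + (1 - t) *: (x - z).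
    by apply/matrixP => i j; rewrite !mxE; ring.
  by move/convex_setP: (convex_hull_convex [set` s]); apply.
move=> _ /= /mapP[y ys ->]; rewrite /D /= subKr.
exact: sub_convex_hull.
Qed.

(** An open half-space together with the single boundary point [x] is convex, so it contains the
    whole hull as soon as it contains [s]. *)
Lemma strict_max_vertex s x (c : 'cV[R]_n) : x \in s ->
  {in s, forall y, y != x -> dotv c y < dotv c x} ->
  vertex (convex_hull [set` s]) x.
Proof.
move=> xs cs.
pose D := [set z | z = x \/ dotv c z < dotv c x].
have hD : convex_hull [set` s] `<=` D.
  apply: convex_hull_sub.
    apply/convex_setP => y z t t0 t1; rewrite /D /= => Dy Dz.
    have [->|tn0] := eqVneq t 0; first by rewrite scale0r add0r subr0 scale1r.
    have [->|tn1] := eqVneq t 1; first by rewrite subrr scale0r addr0 scale1r.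
    have t0' : 0 < t by rewrite lt_neqAle eq_sym tn0.
    have t1' : t < 1 by rewrite lt_neqAle tn1.
    case: Dy Dz => [->|Dy] [->|Dz]; [left|right|right|right].
    - by rewrite -scalerDl subrKC scale1r.
    - by rewrite !dotv_lin; nra.
    - by rewrite !dotv_lin; nra.
    - by rewrite !dotv_lin; nra.
  by move=> y /= ys; have [->|yx] := eqVneq y x; [left|right; apply: cs].
exists c, (dotv c x); split=> [y /hD [->//|/ltW//]|].
apply/seteqP; split=> [_ ->|y [/hD [->//|/= /lt_eqF/eqP//]]].
by split=> //; apply: sub_convex_hull.
Qed.

(* A minimal generating set consists of vertices: a generator which is not
   one lies in the hull of the others and can be dropped. *)
Lemma polytope_sub_hull_vertices (P : set 'cV[R]_n) :
  polytope P -> P `<=` convex_hull (vertex P).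
Proof.
move=> [_ [/finite_seqP[s ->] PE]].
have [l] := ubnP (size s); elim: l s PE => // l IHl s PE; rewrite ltnS => sl.
have [sP|/existsNP[x /not_implyP[xs xP]]] :=
  pselect (forall x, x \in s -> vertex P x).
  rewrite {1}PE; apply: convex_hull_sub; first exact: convex_hull_convex.
  by move=> x /= /sP /sub_convex_hull.
pose s' := [seq y <- s | y != x].
have [[c cs]|hx] := separate_from_hull s' x.
  exfalso; apply: xP; rewrite PE; apply: (strict_max_vertex _ _ c) => //.
  by move=> y ys yx; apply: cs; rewrite mem_filter yx.
apply: (IHl s'); last first.
  rewrite (leq_trans _ sl) // size_filter -(count_predC (predC1 x) s).
  rewrite -addn1 leq_add2l -has_count; apply/hasP; exists x => //=.
  by rewrite negbK.
rewrite PE; apply/seteqP; split; apply: convex_hull_sub;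
  do ?exact: convex_hull_convex.
  move=> y /= ys; have [->//|yx] := eqVneq y x.
  by apply: sub_convex_hull; rewrite /= mem_filter yx.
by move=> y /=; rewrite mem_filter => /andP[_ ys]; apply: sub_convex_hull.
Qed.

(** The image of the standard simplex under [V] is convex and contains the vertices, hence their
    hull. *)
Lemma polytope_convex_combination (v : nat) (V : 'M[R]_(n, v))
    (P : set 'cV[R]_n) x : polytope P -> vertex_matrix P V -> P x ->
  exists z, [/\ nonneg_orthant z, dotv ones z = 1 & x = V *m z].
Proof.
move=> Ppoly [_ _ Pvert] /(polytope_sub_hull_vertices _ Ppoly).
pose C := [set x | exists z : 'cV[R]_v,
  [/\ nonneg_orthant z, dotv ones z = 1 & x = V *m z]].
suff : convex_hull (vertex P) `<=` C by apply.
apply: convex_hull_sub.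
  apply/convex_setP => _ _ t t0 t1 [y [y0 y1 ->]] [z [z0 z1 ->]].
  exists (t *: y + (1 - t) *: z); split.
  - move=> i; rewrite !mxE.
    by apply: addr_ge0; apply: mulr_ge0; rewrite ?subr_ge0.
  - by rewrite !dotv_lin y1 z1; ring.
  - by rewrite mulmxDr -!scalemxAr.
move=> p /Pvert[j ->]; exists (delta_mx j 0); split.
- by move=> i; rewrite mxE ler0n.
- rewrite dotv_onesE (bigD1 j) //= big1 => [|i /negPf ij]; rewrite mxE ?ij //.
  by rewrite !eqxx addr0.
- by rewrite colE.
Qed.

End ConvexHull.

(** * Norm estimates and the inner cone *)

(** With [w = D *m z], [dotv w w] is the [z]-weighted average of the products of [w] with the
    columns of [D], each at most [norm12 D * enorm w]; one factor [enorm w] then cancels. *)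
Lemma enorm_mulmx_simplex (R : realType) (f v : nat) (D : 'M[R]_(f, v))
    (z : 'cV[R]_v) : nonneg_orthant z -> dotv ones z = 1 ->
  enorm (D *m z) <= norm12 D.
Proof.
move=> z0 z1; set w := D *m z.
have : dotv w w <= norm12 D * enorm w.
  rewrite {1}/w dotv_adjoint /dotv.
  rewrite -[leRHS]mul1r -z1 dotv_onesE mulr_suml; apply: ler_sum => j _.
  apply: ler_wpM2l; first exact: z0.
  have -> : (D^T *m w) j 0 = dotv (col j D) w.
    by rewrite mxE; apply: eq_bigr => i _; rewrite !mxE.
  apply: le_trans (ler_norm _) _; apply: le_trans (cauchy_schwarz _ _) _.
  by apply: ler_wpM2r; [exact: enorm_ge0|exact: le_bigmax].
rewrite -sqr_enorm expr2.
have [->|w0] := eqVneq (enorm w) 0; first by rewrite bigmax_ge_id.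
by rewrite ler_pM2r // lt_neqAle eq_sym w0 enorm_ge0.
Qed.

Lemma cone_in_ball (R : realType) (k : nat) (e : R) (w : 'cV[R]_k) :
  enorm w <= e -> cone_in (e *: ones + w).
Proof.
move=> we; have e0 : 0 <= e := le_trans (enorm_ge0 w) we.
(* For [k = 0] both sides are 0; otherwise [k - 1] is nonnegative and squaring is faithful. *)
rewrite /cone_in /=; have [k0|k0] := posnP k.
  subst k; rewrite dotv_onesE big_ord0.
  by rewrite /enorm /dotv big_ord0 sqrtr0 mulr0.
have k1 : 1 <= k%:R :> R by rewrite ler1n.
set s := dotv ones w.
have q0 := dotv_ge0 w.
have qe : dotv w w <= e ^+ 2 by rewrite -enorm_le.
(* A crude bound, from [enorm ones <= k]; it only serves to show that the right-hand side is
   nonnegative before squaring. *)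
have sk : `|s| <= k%:R * e.
  apply: le_trans (cauchy_schwarz _ _) _.
  apply: ler_pM => //; try exact: enorm_ge0.
  by rewrite enorm_le ?ler0n // dotv_ones; nra.
have rhs0 : 0 <= dotv ones (e *: ones + w).
  rewrite dotvDr dotvZr dotv_ones -/s; have := ler_norm (- s).
  by rewrite normrN; lra.
rewrite -ler_sqr ?nnegrE ?mulr_ge0 ?sqrtr_ge0 // exprMn sqr_sqrtr ?subr_ge0 //.
rewrite sqr_enorm !dotv_lin (dotvC w) dotv_ones -/s -subr_ge0.
(* The difference of the squared sides equals this sum of two nonnegative terms. *)
apply: (@le_trans _ _ ((e + s) ^+ 2 + (k%:R - 1) * (e ^+ 2 - dotv w w))).
  by rewrite addr_ge0 ?sqr_ge0 // mulr_ge0 // subr_ge0.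
by rewrite le_eqVlt; apply/orP; left; apply/eqP; ring.
Qed.

Lemma cone_inZ (R : realType) (k : nat) (a : R) (x : 'cV[R]_k) :
  0 <= a -> cone_in x -> cone_in (a *: x).
Proof.
move=> a0; rewrite /cone_in /= => h.
rewrite /enorm !dotv_lin mulrA -expr2 sqrtrM ?sqr_ge0 // sqrtr_sqr ger0_norm //.
by rewrite mulrCA ler_wpM2l.
Qed.

(** The all-ones matrix sends [z] to [dotv ones z *: ones]. *)
Lemma slack_mulmx (R : realType) (n f v : nat) (H : 'M[R]_(n, f))
    (V : 'M[R]_(n, v)) (z : 'cV[R]_v) :
  slack_matrix H V *m z = dotv ones z *: ones - H^T *m (V *m z).
Proof.
have -> : slack_matrix H V = const_mx 1 - H^T *m V.
  apply/matrixP => i j; rewrite !mxE; congr (_ - _).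
  by apply: eq_bigr => l _; rewrite !mxE.
rewrite mulmxBl mulmxA; congr (_ - _); apply/matrixP => i j.
rewrite ord1 !mxE mulr1 dotv_onesE; apply: eq_bigr => l _.
by rewrite mxE mul1r.
Qed.

Theorem proposition2p24 (R : realType) (n f v m : nat)
    (H : 'M[R]_(n, f)) (V : 'M[R]_(n, v)) (P : set 'cV[R]_n)
    (K : set 'cV[R]_m) (A : 'M[R]_(m, f)) (B : 'M[R]_(m, v))
    (PE : P = polyhedron H)
    (P_polytope : polytope P)
    (P_full : has_dim P n)
    (P_origin : interior P 0)
    (H_facets : facet_matrix P H)
    (V_vertices : vertex_matrix P V)
    (K_closed : closed K)
    (K_cone : convex_cone K)
    (A_nonneg : nonneg_map (dual_cone K) A)
    (AK_closed : closed ((fun y : 'cV[R]_m => A^T *m y) @` K))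
    (B_nonneg : nonneg_map K B) :
  let Delta := slack_matrix H V - A^T *m B in
  dilate (1 / (1 + norm12 Delta)) P `<=` Inn H K A /\
  Out V K B `<=` dilate (1 + norm2oo Delta) P.
Proof.
(* The weight [dotv ones z] stays general: it is 1 for the inner inclusion but only at most 1 for
   the outer one. *)
move=> Delta; have DeltaE z :
    Delta *m z = dotv ones z *: ones - H^T *m (V *m z) - A^T *m (B *m z).
  by rewrite mulmxBl slack_mulmx -(mulmxA A^T).
have [_ _ KZ] := K_cone; split.
  move=> _ [x Px <-].
  have [z [z0 z1 ->]] :=
    polytope_convex_combination _ _ _ _ P_polytope V_vertices Px.
  (* The maximum starts from 0, so this holds even without columns. *)
  have eps0 : 0 <= norm12 Delta by exact: bigmax_ge_id.
  have le_eps := enorm_mulmx_simplex _ _ _ Delta _ z0 z1.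
  set e := norm12 Delta in eps0 le_eps *.
  have e1 : 0 < 1 + e by lra.
  have a0 : 0 <= 1 / (1 + e) by rewrite divr_ge0 // ltW.
  exists ((1 / (1 + e)) *: (B *m z)); split.
    by apply: KZ => //; apply: B_nonneg; exists z.
  have := cone_inZ _ _ _ _ a0 (cone_in_ball _ _ _ _ le_eps); congr cone_in.
  rewrite DeltaE z1 -!scalemxAr; apply/matrixP => i j; rewrite !mxE.
  by field; rewrite gt_eqF.
move=> _ [z [zO z1 KBz] <-].
have eps0 : 0 <= norm2oo Delta by exact: bigmax_ge_id.
set e := norm2oo Delta in eps0 *.
have e1 : 0 < 1 + e by lra.
exists ((1 + e)^-1 *: (V *m z)); last first.
  by rewrite scalerA mulfV ?gt_eqF // scale1r.
rewrite PE => i; rewrite -scalemxAr mxE mulrC ler_pdivrMr // mul1r.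
have AB0 : 0 <= (A^T *m (B *m z)) i 0.
  have -> : (A^T *m (B *m z)) i 0 = dotv (A *m delta_mx i 0) (B *m z).
    by rewrite -colE mxE; apply: eq_bigr => l _; rewrite !mxE.
  have /A_nonneg : [set A *m x | x in @nonneg_orthant R f] (A *m delta_mx i 0).
    by exists (delta_mx i 0) => // l; rewrite mxE ler0n.
  by apply.
have De : `|(Delta *m z) i 0| <= e.
  have -> : (Delta *m z) i 0 = dotv (col i Delta^T) z.
    by rewrite mxE; apply: eq_bigr => l _; rewrite !mxE.
  apply: le_trans (cauchy_schwarz _ _) _; rewrite -[leRHS]mulr1.
  apply: ler_pM; rewrite ?enorm_ge0 //; first exact: le_bigmax.
  exact: le_trans zO z1.
(* Only the lower bound [- e <= (Delta *m z) i 0] matters, since this entry enters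
   [(H^T *m (V *m z)) i 0] with a minus sign. *)
move: De; rewrite ler_norml => /andP[+ _].
have -> : (Delta *m z) i 0 =
    dotv ones z - (H^T *m (V *m z)) i 0 - (A^T *m (B *m z)) i 0.
  by rewrite DeltaE !mxE mulr1.
lra.
Qed.
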